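(* Let $\theta\in\mathcal D$. For any $y\in\mathcal Y^{sep}$ there exists a decomposable function $\Psi\in L^2(\Omega;W)$ (that is, $\Psi\in\mathcal Y^{sep}$) which solves the extended adjoint equation $$D(\theta)^\star\,\Psi(\cdot,x')=y(\cdot,x')\qquad\text{for a.e. }x'\in\Omega,$$ where $D(\theta)^\star$ acts on the first variable $x$ of $\Psi(x,x')$.
   Context: Setting. $\Omega$ is a smooth domain. $X$ is a real Hilbert space (parameters), $U$ and $W$ are complex Hilbert spaces of functions on $\Omega$, with Gelfand triples $U\hookrightarrow L^2(\Omega)\hookrightarrow U^*$, $W\hookrightarrow L^2(\Omega)\hookrightarrow W^*$ (dense continuous embeddings, $L^2(\Omega)=L^2(\Omega;\mathbb C)$). The PDE model is affine bilinear: $D(\theta)u:=Ku+B(u)\theta$ with $K\in\mathcal L(U,W^* )$, $B\in\mathcal L(U,\mathcal L(X,W^* ))$, so $D(\theta)\in\mathcal L(U,W^* )$. On a domain $\mathcal D\subseteq X$, $D(\theta)$ is boundedly invertible: $D(\theta)^{-1}\in\mathcal L(W^*,U)$. $D(\theta)^\star\in\mathcal L(W,U^* )$ denotes the Banach space adjoint with respect to the canonical complex dual pairings. Decomposable functions: $\mathcal Y^{sep}:=\{y\in L^2(\Omega\times\Omega): \exists I<\infty,\ y(x,x')=\sum_{i=1}^I p_i(x)q_i(x'),\ p_i,q_i\in L^2(\Omega)\}$. $L^2(\Omega;W)$ is the Bochner space with norm $\|\Psi\|=\big(\int_\Omega\|\Psi(\cdot,x')\|_W^2\,dx'\big)^{1/2}$,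 viewed as a subspace of $L^2(\Omega\times\Omega)$. The function $\Psi$ is called the extended adjoint state. *)

(* Defs.v *)
From HB Require Import structures.
From mathcomp Require Import all_boot all_order all_algebra.
From mathcomp Require Import sesquilinear complex.
From mathcomp Require Import all_classical all_reals all_analysis.

Set Implicit Arguments.
Unset Strict Implicit.
Unset Printing Implicit Defensive.

Import Order.TTheory GRing.Theory Num.Theory.
Import numFieldNormedType.Exports.

Local Open Scope classical_set_scope.
Local Open Scope ring_scope.

(* Points of R^d are tuples because the library equips tuples, and not row
   vectors, with the product sigma-algebra. *)
Definition Rn (R : realType) (d : nat) := d.-tuple (measurableTypeR R).

HB.instance Definition _ (R : realType) (d : nat) := Measurable.on (Rn R d).

Section lebesgue_step.
Variables (R : realType) (d : nat).

Definition cons_Rn (x : measurableTypeR R * Rn R d) : Rn R d.+1 :=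
  [tuple of x.1 :: x.2].

Let measurable_cons_Rn : measurable_fun [set: _] cons_Rn.
Proof. exact: measurable_cons. Qed.

HB.instance Definition _ :=
  isMeasurableFun.Build _ _ _ _ cons_Rn measurable_cons_Rn.

Variable m : {sigma_finite_measure set (Rn R d) -> \bar R}.

Definition lebesgue_step : set (Rn R d.+1) -> \bar R :=
  pushforward (@lebesgue_measure R \x m)%E cons_Rn.

Let lebesgue_step0 : lebesgue_step set0 = 0%E.
Proof. exact: measure0. Qed.

Let lebesgue_step_ge0 A : (0 <= lebesgue_step A)%E.
Proof. exact: measure_ge0. Qed.

Let lebesgue_step_sigma_additive : semi_sigma_additive lebesgue_step.
Proof. exact: measure_semi_sigma_additive. Qed.

HB.instance Definition _ := isMeasure.Build _ _ _ lebesgue_step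
  lebesgue_step0 lebesgue_step_ge0 lebesgue_step_sigma_additive.

Let uncons (x : Rn R d.+1) : measurableTypeR R * Rn R d :=
  (thead x, [tuple of behead x]).

Let measurable_uncons : measurable_fun [set: _] uncons.
Proof.
apply/measurable_fun_pairP; split; first exact: measurable_tnth.
exact: measurable_behead.
Qed.

Let lebesgue_step_sigma_finite : sigma_finite [set: Rn R d.+1] lebesgue_step.
Proof.
have /sigma_finiteP[F [TF ndF Foo]] := sigma_finiteT (@lebesgue_measure R).
have /sigma_finiteP[G [TG ndG Goo]] := sigma_finiteT m.
exists (fun n => uncons @^-1` (F n `*` G n)).
  rewrite -preimage_bigcup; apply/seteqP; split => // x _ /=.
  have [i _ Fi] : (\bigcup_i F i) (thead x) by rewrite -TF.
  have [j _ Gj] : (\bigcup_i G i) [tuple of behead x] by rewrite -TG.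
  exists (maxn i j) => //; split => /=.
    by move: Fi; exact/subsetPset/ndF/leq_maxl.
  by move: Gj; exact/subsetPset/ndG/leq_maxr.
move=> n; have [mF Fnoo] := Foo n; have [mG Gnoo] := Goo n; split.
  rewrite -[X in measurable X]setTI; apply: measurable_uncons => //.
  exact: measurableX.
rewrite /lebesgue_step /pushforward -comp_preimage.
rewrite (_ : uncons \o cons_Rn = id); last first.
  apply/funext => -[x t] /=.
  by rewrite /uncons theadE; congr pair; exact: val_inj.
by rewrite preimage_id product_measure1E// lte_mul_pinfty// ge0_fin_numE.
Qed.

HB.instance Definition _ := Measure_isSigmaFinite.Build _ _ _ lebesgue_step
  lebesgue_step_sigma_finite.

End lebesgue_step.

Fixpoint lebesgue_Rn (R : realType) (d : nat) :
    {sigma_finite_measure set (Rn R d) -> \bar R} :=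
  match d with
  | 0 => \d_([tuple] : Rn R 0)
  | d'.+1 => lebesgue_step (lebesgue_Rn R d')
  end.

Section smooth_domain.
Variables (R : realType) (d : nat).
Implicit Types (f rho : 'rV[R]_d -> R) (V : set 'rV[R]_d).

(* C^k on an open set V; all directional derivatives are required, which is
   the same as all partial derivatives. *)
Fixpoint continuously_differentiable (k : nat) V f : Prop :=
  (forall x, V x -> {for x, continuous f}) /\
  (if k is k'.+1 then
     forall v, (forall x, V x -> derivable f x v) /\
               continuously_differentiable k' V ('D_v f)
   else True).

(* The topology lives on row vectors, so sets of tuples are transported. *)
Definition row_set (Omega : set (Rn R d)) : set 'rV[R]_d :=
  [set v | Omega [tuple v 0 i | i < d]].

(* Near each boundary point Omega is the sublevel set of a C^infinity
   defining function with nonvanishing gradient. *)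
Definition smooth_boundary (O : set 'rV[R]_d) : Prop :=
  forall x, (closure O `\` O) x ->
  exists V rho, [/\ open V, V x,
    forall k, continuously_differentiable k V rho,
    forall y, V y -> exists v, 'D_v rho y != 0
    & O `&` V = [set y | rho y < 0] `&` V].

Definition smooth_domain (Omega : set (Rn R d)) : Prop :=
  let O := row_set Omega in
  [/\ open O, connected O, O !=set0 & smooth_boundary O].

End smooth_domain.

(* Norms on a module over R[i] are R[i]-valued in the library. *)
Definition rnorm (R : realType) (V : normedZmodType R[i]) (v : V) : R :=
  complex.Re `|v|.

Definition complex_hilbert (R : realType) (V : completeNormedModType R[i]) :=
  exists dot : {dot V for Num.conj}, forall v, dot v v = `|v| ^+ 2.

Definition real_hilbert (R : realType) (V : completeNormedModType R) :=
  exists dot : {dot V for idfun}, forall v, dot v v = `|v| ^+ 2.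

Section operators.
Variables (R : realType) (X : normedModType R) (U V : normedModType R[i]).

(* V^* is the space of bounded conjugate-linear functionals, with the pairing
   <f, v> = f v linear in f and conjugate-linear in v. *)
Definition in_antidual (f : V -> R[i]) : Prop :=
  (forall a v w, f (a *: v + w) = Num.conj a * f v + f w) /\
  exists M : R, forall v, rnorm (f v) <= M * rnorm v.

(* The suprema below are only used on sets that are bounded above, by the
   membership conditions preceding them in each predicate. *)
Definition antidual_norm (f : V -> R[i]) : R :=
  sup [set rnorm (f v) | v in [set v | rnorm v <= 1]].

(* A \in L(U, V^* ) *)
Definition bounded_to_antidual (A : U -> V -> R[i]) : Prop :=
  [/\ forall u, in_antidual (A u),
      forall a u u' v, A (a *: u + u') v = a * A u v + A u' v
    & exists M : R, forall u, antidual_norm (A u) <= M * rnorm u].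

(* A \in L(X, V^* ), with X real *)
Definition real_bounded_to_antidual (A : X -> V -> R[i]) : Prop :=
  [/\ forall x, in_antidual (A x),
      forall (a : R) x x' v, A (a *: x + x') v = a%:C%C * A x v + A x' v
    & exists M : R, forall x, antidual_norm (A x) <= M * `|x|].

Definition real_opnorm (A : X -> V -> R[i]) : R :=
  sup [set antidual_norm (A x) | x in [set x | `|x| <= 1]].

(* B \in L(U, L(X, V^* )) *)
Definition bounded_bilinear (B : U -> X -> V -> R[i]) : Prop :=
  [/\ forall u, real_bounded_to_antidual (B u),
      forall a u u' x v, B (a *: u + u') x v = a * B u x v + B u' x v
    & exists M : R, forall u, real_opnorm (B u) <= M * rnorm u].

Definition boundedly_invertible (A : U -> V -> R[i]) : Prop :=
  exists S : (V -> R[i]) -> U,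
    [/\ forall u, S (A u) = u,
        forall f, in_antidual f -> A (S f) = f,
        forall a f g, in_antidual f -> in_antidual g ->
          S (fun v => a * f v + g v) = a *: S f + S g
      & exists M : R, forall f, in_antidual f ->
          rnorm (S f) <= M * antidual_norm f].

(* <A^* v, u> is the conjugate of <A u, v>; thus A^* maps V = V^** to U^*. *)
Definition adjoint (A : U -> V -> R[i]) (v : V) (u : U) : R[i] :=
  Num.conj (A u v).

Definition model (K : U -> V -> R[i]) (B : U -> X -> V -> R[i]) (theta : X) :
    U -> V -> R[i] :=
  fun u v => K u v + B u theta v.

End operators.

(* Elements of L^2 are represented by functions, considered on D only, and
   identified when they agree almost everywhere on D. *)
Section L2.
Context d (T : measurableType d) (R : realType).
Variables (mu : {measure set T -> \bar R}) (D : set T).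

Definition L2norm (V : normedZmodType R[i]) (f : T -> V) : \bar R :=
  ('N[mu]_(2%:E) [ (fun x => (rnorm (f x))%:E) \_ D ])%E.

Definition complex_measurable (f : T -> R[i]) : Prop :=
  measurable_fun D (fun x => complex.Re (f x)) /\
  measurable_fun D (fun x => complex.Im (f x)).

Definition L2 (f : T -> R[i]) : Prop :=
  complex_measurable f /\ (L2norm f < +oo)%E.

Definition complex_integral (f : T -> R[i]) : R[i] :=
  (Rintegral mu D (fun x => complex.Re (f x)) +i*
   Rintegral mu D (fun x => complex.Im (f x)))%C.

Section vector_valued.
Variable V : normedModType R[i].

Definition simple_on (s : T -> V) : Prop :=
  finite_set (s @` D) /\ forall v, measurable (D `&` s @^-1` [set v]).

Definition strongly_measurable (f : T -> V) : Prop :=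
  exists s : nat -> T -> V, (forall n, simple_on (s n)) /\
    \forall x \ae mu, D x -> (fun n => s n x) @ \oo --> f x.

Definition bochner_L2 (f : T -> V) : Prop :=
  strongly_measurable f /\ (L2norm f < +oo)%E.

(* [i v] is a representative of the image of v under an embedding of V in
   L^2(D). The second embedding L^2(D) -> V^* of the triple is
   [L2_to_antidual]: it is determined by the first one, and its continuity,
   injectivity and density follow. *)
Definition gelfand_triple (i : V -> T -> R[i]) : Prop :=
  [/\ forall v, L2 (i v),
      forall a v w,
        i (a *: v + w) = (fun x => a * i v x + i w x) %[ae mu in D],
      forall v, i v = (fun=> 0) %[ae mu in D] -> v = 0,
      exists M : R, forall v, (L2norm (i v) <= (M * rnorm v)%:E)%E
    & forall f (e : R), L2 f -> 0 < e ->
        exists v, (L2norm (fun x => (f x - i v x)%R) < e%:E)%E].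

Definition L2_to_antidual (i : V -> T -> R[i]) (f : T -> R[i]) (v : V) : R[i] :=
  complex_integral (fun x => f x * Num.conj (i v x)).

End vector_valued.
End L2.

Section decomposable.
Context d (T : measurableType d) (R : realType).
Variables (mu : {sigma_finite_measure set T -> \bar R}) (D : set T).

Definition Ysep (y : T * T -> R[i]) : Prop :=
  L2 (mu \x mu)%E (D `*` D) y /\
  exists (I : nat) (p q : 'I_I -> T -> R[i]),
    [/\ forall i, L2 mu D (p i), forall i, L2 mu D (q i)
      & y = (fun z => \sum_(i < I) p i z.1 * q i z.2)
          %[ae (mu \x mu)%E in D `*` D]].

(* The V-valued function Psi, viewed as the function psi of two variables:
   psi(., x') is the image of Psi x' in L^2(D). *)
Definition viewed_as (V : normedModType R[i]) (i : V -> T -> R[i])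
    (Psi : T -> V) (psi : T * T -> R[i]) : Prop :=
  \forall x' \ae mu, D x' -> i (Psi x') = (fun x => psi (x, x')) %[ae mu in D].

End decomposable.

(* Main.v *)
Require Import Defs.
From mathcomp Require Import all_boot all_order all_algebra.
From mathcomp Require Import sesquilinear complex ring lra.
From mathcomp Require Import all_classical all_reals all_analysis.
From mathcomp Require Import measurable_realfun.

(** Write y(x, x') = sum_k p_k(x) q_k(x'). Each p_k is an element of U^*, and
    D(theta)^* is onto U^* because D(theta) is boundedly invertible and W is
    reflexive (Riesz); choose w_k in W with D(theta)^* w_k = p_k. By linearity
    Psi(., x') = sum_k q_k(x') w_k is a decomposable solution. *)

Set Implicit Arguments.
Unset Strict Implicit.
Unset Printing Implicit Defensive.

Import Order.TTheory GRing.Theory Num.Theory.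
Import numFieldNormedType.Exports.
Import HBSimple.

Local Open Scope classical_set_scope.
Local Open Scope ring_scope.

(** Functionals are conjugate-linear and [adjoint] conjugates once more, so [adjoint A] is linear on
    W and the coefficients q_k(x') pass through it unconjugated. Riesz enters twice: it represents
    the functional g o A^-1 on W by the solution, and it writes each [A u] as a [dot], which is how
    the solution is tested against u. Decomposability leaves only finitely many equations in x to
    solve, so no solution has to be selected measurably in x'. The remaining work is with
    representatives: [iU] and [iW] are linear only almost everywhere, and y equals its sum only
    almost everywhere on the product. Tonelli turns the latter into an equality on almost every
    section, with an exceptional set of x' that does not depend on u; the equation is then a single
    equality in U^*. *)

(** * Real-valued norms over the complex scalars *)

Section rnorm_theory.
Context {R : realType}.
Implicit Types z : R[i].

Lemma rnormE {V : normedZmodType R[i]} (v : V) : `|v| = (rnorm v)%:C%C.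
Proof. by rewrite /rnorm RRe_real// normr_real. Qed.

Lemma rnorm_ge0 {V : normedZmodType R[i]} (v : V) : 0 <= rnorm v.
Proof. by rewrite -ler0c -rnormE. Qed.

Lemma rnorm0 {V : normedZmodType R[i]} : rnorm (0 : V) = 0.
Proof. by rewrite /rnorm normr0. Qed.

Lemma rnormN {V : normedZmodType R[i]} (v : V) : rnorm (- v) = rnorm v.
Proof. by rewrite /rnorm normrN. Qed.

Lemma ler_rnormD {V : normedZmodType R[i]} (v w : V) :
  rnorm (v + w) <= rnorm v + rnorm w.
Proof. by rewrite -lecR rmorphD/= -!rnormE ler_normD. Qed.

Lemma rnormZ {V : normedModType R[i]} a (v : V) : rnorm (a *: v) = rnorm a * rnorm v.
Proof. by apply: complexI; rewrite rmorphM/= -!rnormE normrZ. Qed.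

Lemma rnormM a b : rnorm (a * b : R[i]) = rnorm a * rnorm b.
Proof. by apply: complexI; rewrite rmorphM/= -!rnormE normrM. Qed.

Lemma rnorm_real (x : R) : rnorm (x%:C%C : R[i]) = `|x|.
Proof.
by rewrite /rnorm normc_def/= expr0n/= addr0 sqrtr_sqr.
Qed.

Lemma rnorm_conj z : rnorm z^*%C = rnorm z.
Proof. by rewrite /rnorm normcJ. Qed.

Lemma ler_Re_rnorm z : `|complex.Re z| <= rnorm z.
Proof. by rewrite -lecR -rnormE normc_ge_Re. Qed.

Lemma sqr_rnorm z : rnorm z ^+ 2 = complex.Re z ^+ 2 + complex.Im z ^+ 2.
Proof. by apply: complexI; rewrite add_Re2_Im2 rmorphXn/= -rnormE. Qed.

Lemma ler_Im_rnorm z : `|complex.Im z| <= rnorm z.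
Proof.
rewrite -(ler_pXn2r (n := 2))// ?nnegrE ?rnorm_ge0// sqr_rnorm real_normK ?num_real//.
by rewrite lerDr sqr_ge0.
Qed.

Lemma ler_rnorm_ReIm z : rnorm z <= `|complex.Re z| + `|complex.Im z|.
Proof.
rewrite -(ler_pXn2r (n := 2))// ?nnegrE ?rnorm_ge0 ?addr_ge0// sqr_rnorm.
rewrite sqrrD !real_normK ?num_real//.
have : 0 <= `|complex.Re z| * `|complex.Im z| by rewrite mulr_ge0.
by lra.
Qed.

Lemma conjcE z : Num.conj z = z^*%C.
Proof. by []. Qed.

End rnorm_theory.

Section convergence.
Context {R : realType} {V : normedModType R[i]}.

(** Radii of balls in [V] live in [R[i]], but a positive element of [R[i]] is real, so real radii
    suffice. *)
Lemma cvg_rnormP {T : Type} {F : set_system T} {FF : Filter F} (f : T -> V) (l : V) :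
  f @ F --> l <-> forall e : R, 0 < e -> \forall t \near F, rnorm (l - f t) < e.
Proof.
split=> [/cvgrPdist_lt h e e0|h].
  have /h : 0 < e%:C%C by rewrite ltcR.
  by apply: filterS => t; rewrite rnormE ltcR.
apply/cvgrPdist_lt => e e0.
have er : e = (complex.Re e)%:C%C by rewrite RRe_real// gtr0_real.
move: e0; rewrite er ltcR => /h.
by apply: filterS => t; rewrite rnormE ltcR.
Qed.

End convergence.

(** * Cauchy-Schwarz and Riesz representation *)

Section riesz.
Context {R : realType} {V : completeNormedModType R[i]}.
Variable dot : {dot V for Num.conj}.
Hypothesis dotE : forall v, dot v v = `|v| ^+ 2.

Lemma Re_dotvv v : complex.Re (dot v v) = rnorm v ^+ 2.
Proof. by rewrite dotE rnormE -rmorphXn. Qed.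

Lemma dot_conj u v : dot u v = (dot v u)^*%C.
Proof. by rewrite (hermC dot u v) expr0 mul1r. Qed.

Lemma dotDl u v w : dot (u + v) w = dot u w + dot v w.
Proof. exact: linearDl. Qed.

Lemma dotZl a u v : dot (a *: u) v = a * dot u v.
Proof. exact: linearZl_LR. Qed.

Lemma dotDr u v w : dot w (u + v) = dot w u + dot w v.
Proof. exact: linearDr. Qed.

Lemma dotZr a u v : dot u (a *: v) = a^*%C * dot u v.
Proof. exact: linearZr_LR. Qed.

Lemma Re_dotC u v : complex.Re (dot u v) = complex.Re (dot v u).
Proof. by rewrite dot_conj; case: (dot v u). Qed.

(** With [t] real only the real part of [dot] appears. This one expansion yields Cauchy-Schwarz, the
    parallelogram law (t = 1 and t = -1) and the first variation. *)
Lemma sqr_rnormDZ (t : R) u v : rnorm (u + t%:C%C *: v) ^+ 2 =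
  rnorm u ^+ 2 + 2 * t * complex.Re (dot v u) + t ^+ 2 * rnorm v ^+ 2.
Proof.
rewrite -!Re_dotvv !(dotDl, dotDr, dotZl, dotZr) !raddfD/=.
have E z : complex.Re (t%:C%C * z) = t * complex.Re z.
  by case: z => a b /=; rewrite mul0r subr0.
have -> : (t -i* 0)%C = t%:C%C :> R[i] by rewrite oppr0.
rewrite !E [complex.Re (dot u v)]Re_dotC; ring.
Qed.

Lemma Re_dot_le u v : complex.Re (dot u v) <= rnorm u * rnorm v.
Proof.
have [->|v0] := eqVneq v 0.
  by rewrite [dot u 0]linear0r rnorm0 mulr0.
have nv0 : 0 < rnorm v by rewrite -ltcR -rnormE normr_gt0.
have nu0 := rnorm_ge0 u.
(* For this factor t the vectors u and t v have equal norm, and the square is 2|u|^2 - 2(|u|/|v|)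
   Re(dot u v). *)
have := sqr_ge0 (rnorm (u + (- (rnorm u / rnorm v))%:C%C *: v)).
rewrite sqr_rnormDZ Re_dotC sqrrN expr_div_n mulfVK ?expf_neq0 ?gt_eqF//.
move=> h.
have [->|u0] := eqVneq u 0.
  by rewrite [dot 0 v]linear0l rnorm0 mul0r.
have {}nu0 : 0 < rnorm u by rewrite -ltcR -rnormE normr_gt0.
have : complex.Re (dot u v) * (rnorm u / rnorm v) <= rnorm u ^+ 2 by lra.
rewrite -ler_pdivlMr ?divr_gt0// invf_div.
by rewrite expr2 -mulrA [X in _ * X]mulrCA divff ?gt_eqF// mulr1.
Qed.

(** Multiplying [u] by the conjugate of [dot u v] makes the product equal to |dot u v|^2, which is
    real; one factor |dot u v| then cancels from the bound on real parts. *)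
Lemma cauchy_schwarz u v : rnorm (dot u v) <= rnorm u * rnorm v.
Proof.
have [e0|n0] := eqVneq (rnorm (dot u v)) 0.
  by rewrite e0 mulr_ge0// rnorm_ge0.
have {}n0 : 0 < rnorm (dot u v) by rewrite lt_neqAle eq_sym n0 rnorm_ge0.
have := Re_dot_le ((dot u v)^*%C *: u) v.
rewrite dotZl rnormZ rnorm_conj -mulrA mulrC -sqr_normc.
by rewrite rnormE -rmorphXn/= expr2 ler_pM2l.
Qed.

Lemma parallelogram (u v : V) :
  rnorm (u + v) ^+ 2 + rnorm (u - v) ^+ 2 = 2 * (rnorm u ^+ 2 + rnorm v ^+ 2).
Proof.
have := sqr_rnormDZ 1 u v; have := sqr_rnormDZ (-1) u v.
rewrite rmorphN rmorph1 scaleN1r scale1r => -> ->; ring.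
Qed.

(* The representative minimises the energy [|w|^2 - 2 Re (f w)]: minimising
   sequences are Cauchy by the parallelogram law, and the minimum is the
   representative because the first variation vanishes. *)
Lemma riesz_representation (f : V -> R[i]) : in_antidual f ->
  exists w, f = dot w.
Proof.
move=> [flin [M fM]].
have fD u v : f (u + v) = f u + f v.
  by have := flin 1 u v; rewrite scale1r conjC1 mul1r.
have f0 : f 0 = 0 by apply: (@addrI _ (f 0)); rewrite -fD !addr0.
have fZ a u : f (a *: u) = a^*%C * f u.
  by have := flin a u 0; rewrite addr0 f0 addr0.
have reZ (t : R) u : complex.Re (f (t%:C%C *: u)) = t * complex.Re (f u).
  by rewrite fZ conjc_real; case: (f u) => a b /=; rewrite mul0r subr0.
have reD u v : complex.Re (f (u + v)) = complex.Re (f u) + complex.Re (f v).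
  by rewrite fD raddfD.
pose J w := rnorm w ^+ 2 - 2 * complex.Re (f w).
(* J w >= |w|^2 - 2M|w| = (|w| - M)^2 - M^2. *)
have J_ge w : - M ^+ 2 <= J w.
  have := le_trans (ler_norm _) (le_trans (ler_Re_rnorm (f w)) (fM w)).
  have := sqr_ge0 (rnorm w - M); rewrite /J; nra.
pose E := range J.
have infE : has_inf E.
  by split; [exists (J 0), 0|exists (- M ^+ 2) => _ [w _ <-]].
pose m := inf E.
have m_le w : m <= J w by apply: ge_inf; [case: infE|exists w].
have [eps [eps0 inv_lt inv_le]] : exists eps : nat -> R,
    [/\ forall n, 0 < eps n,
        forall e : R, 0 < e -> exists n, eps n < e
      & forall n k, (n <= k)%N -> eps k <= eps n].
  exists (fun n => n.+1%:R^-1); split => [n|e e0|n k nk].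
  - by rewrite invr_gt0.
  - by exists (Num.truncn e^-1); rewrite invf_plt ?posrE// truncnS_gt.
  - by rewrite lef_pV2 ?posrE// ler_nat.
have ex n : exists w, J w < m + eps n.
  by have [_ [w _ <-] h] := inf_adherent (eps0 n) infE; exists w.
have {ex} [w_ w_J] := choice ex.
have half (u : V) : rnorm (2^-1%:C%C *: u) ^+ 2 = 4^-1 * rnorm u ^+ 2.
  by rewrite rnormZ rnorm_real exprMn ger0_norm ?invr_ge0//; field.
(* The parallelogram law gives |u - v|^2 = 2 J(u) + 2 J(v) - 4 J((u + v)/2), and the last value of J
   is at least m. *)
have J_mid u v : rnorm (u - v) ^+ 2 <= 2 * (J u + J v - 2 * m).
  have := m_le (2^-1%:C%C *: (u + v)).
  by have := parallelogram u v; rewrite /J half reZ reD; nra.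
have : cauchy (w_ @ \oo).
  apply: cauchy_exP => e e0.
  have er : e = (complex.Re e)%:C%C by rewrite RRe_real// gtr0_real.
  move: e0; rewrite er ltcR; set r := complex.Re e => r0.
  (* Beyond N both energies exceed m by less than r^2/4, so [J_mid] bounds the squared distance by
     r^2. *)
  have [N NR] := inv_lt (r ^+ 2 / 4) (divr_gt0 (exprn_gt0 2 r0) (ltr0n _ 4)).
  exists (w_ N); exists N => // n /= Nn.
  rewrite -ball_normE /ball_/= rnormE ltcR.
  rewrite -(ltr_pXn2r (n := 2))// ?nnegrE ?rnorm_ge0 ?ltW//.
  suff : 2 * (J (w_ N) + J (w_ n) - 2 * m) < r ^+ 2 by apply: le_lt_trans.
  by have := w_J N; have := w_J n; have := inv_le _ _ Nn; lra.
move=> /cauchy_cvg /cvg_ex[w /cvg_rnormP w_w].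
(* The variation is computed at the approximants [w_ n], where m <= J(w_n + t v) and J(w_n) < m +
   eps n. In the limit the error e is shared equally between eps n and the Cauchy-Schwarz bound on
   2t Re(dot (w - w_n) v). *)
have var (t : R) v : 0 <= t ^+ 2 * rnorm v ^+ 2 +
    2 * t * (complex.Re (dot w v) - complex.Re (f v)).
  apply/ler_addgt0Pr => e e0.
  pose c := 2 * `|t| * rnorm v.
  have c0 : 0 <= c by rewrite !mulr_ge0// rnorm_ge0.
  have d0 : 0 < e / 2 / (c + 1) by rewrite !divr_gt0// ltr_wpDl.
  have [N _ Nw] := w_w _ d0.
  have [k ke] := inv_lt _ (divr_gt0 e0 (ltr0n _ 2)).
  pose n := maxn N k.
  have := Nw n (leq_maxl _ _); rewrite ltr_pdivlMr ?ltr_wpDl// => wn.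
  have := m_le (w_ n + t%:C%C *: v); rewrite /J sqr_rnormDZ reD reZ.
  have := w_J n; rewrite /J; have := inv_le _ _ (leq_maxr N k); rewrite -/n.
  have := le_trans (ler_Re_rnorm _) (cauchy_schwarz (w - w_ n) v).
  rewrite [dot (w - w_ n) v]linearBl raddfB/= [complex.Re (dot v _)]Re_dotC.
  set x := complex.Re (dot w v); set x' := complex.Re (dot (w_ n) v) => xx'.
  have : - (2 * t * (x - x')) <= c * rnorm (w - w_ n).
    apply: le_trans (ler_norm _) _; rewrite normrN !normrM (ger0_norm (ler0n _ 2)).
    by rewrite /c -!mulrA !ler_wpM2l// mulrC.
  have := rnorm_ge0 (w - w_ n).
  lra.
have var0 v : complex.Re (dot w v) = complex.Re (f v).
  apply/eqP; rewrite -subr_eq0; apply/eqP.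
  move: (var^~ v); set D := _ - _; set a := rnorm v ^+ 2 => h.
  have a1 : 0 < a + 1 by rewrite ltr_wpDl// sqr_ge0.
  (* This t makes the quadratic negative unless D = 0; the 1 keeps the denominator positive when v =
     0. *)
  have := h (- D / (a + 1)).
  have -> : (- D / (a + 1)) ^+ 2 * a + 2 * (- D / (a + 1)) * D =
    - (D ^+ 2 * (a + 2) / (a + 1) ^+ 2) by field; rewrite gt_eqF.
  rewrite oppr_ge0 ler_pdivrMr ?exprn_gt0// mul0r pmulr_lle0; last lra.
  by move=> D2; apply/eqP; rewrite -sqrf_eq0 eq_le D2 sqr_ge0.
exists w; apply/funext => v; apply/eqP; rewrite eq_complex var0 eqxx/=.
(* Both functionals are conjugate-linear, so their real parts at i v are their imaginary parts at
   v. *)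
have := var0 ('i%C *: v); rewrite fZ dotZr.
by case: (f v) (dot w v) => [a b] [c d]/=; rewrite !mul0r !sub0r !mulN1r !opprK => ->.
Qed.
Lemma in_antidual_dot w : in_antidual (dot w).
Proof.
split=> [a u v|]; last by exists (rnorm w) => v; exact: cauchy_schwarz.
by rewrite dotDr dotZr.
Qed.

(** Cauchy-Schwarz bounds the set under the supremum, and v = 0 puts 0 in it. The lower bound is
    what allows a constant of unknown sign in front of the norm to be replaced by its absolute
    value. *)
Lemma antidual_norm_dot w : 0 <= antidual_norm (dot w) <= rnorm w.
Proof.
have ub : ubound [set rnorm (dot w v) | v in [set v | rnorm v <= 1]] (rnorm w).
  move=> _ [v /= v1 <-]; apply: le_trans (cauchy_schwarz w v) _.
  by rewrite ler_piMr ?rnorm_ge0.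
have d0 : [set rnorm (dot w v) | v in [set v | rnorm v <= 1]] 0.
  by exists 0; rewrite /= ?rnorm0// [dot w 0]linear0r rnorm0.
apply/andP; split; last by apply: ge_sup => //; exists 0.
by apply: ub_le_sup => //; exists (rnorm w).
Qed.

End riesz.

(** * Solvability of the adjoint equation *)

Section adjoint_equation.
Context {R : realType} {U : normedModType R[i]} {W : completeNormedModType R[i]}.

Lemma in_antidualD (V : normedModType R[i]) (f g : V -> R[i]) :
  in_antidual f -> in_antidual g -> in_antidual (fun v => f v + g v).
Proof.
move=> [fl [M fM]] [gl [N gN]]; split=> [a v w|].
  by rewrite fl gl; ring.
exists (M + N) => v; rewrite mulrDl.
exact: le_trans (ler_rnormD _ _) (lerD (fM v) (gN v)).
Qed.

(* By Riesz, [dot w] runs through all of W^*, so [w |-> g (A^-1 (dot w))] is a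
   functional on W; the vector representing it is the solution. *)
Lemma adjoint_surjective (A : U -> W -> R[i]) (g : U -> R[i]) :
  complex_hilbert W -> (forall u, in_antidual (A u)) ->
  boundedly_invertible A -> in_antidual g -> exists w, adjoint A w = g.
Proof.
move=> [dot dotE] Adual [S [SA _ Slin [M SM]]] [glin [N gN]].
have [v gv] : exists v, (fun w => g (S (dot w))) = dot v.
  apply: riesz_representation => //; split=> [a w w'|].
    (* [w |-> dot w] and [S] are linear and [g] is conjugate-linear, so the composite is
       conjugate-linear. *)
    rewrite -glin -Slin; try exact: in_antidual_dot.
    by congr (g (S _)); apply/funext => v; rewrite dotDl dotZl.
  exists (`|N| * `|M|) => w; apply: le_trans (gN _) _.
  rewrite -mulrA (le_trans (ler_wpM2r (rnorm_ge0 _) (ler_norm N)))// ler_wpM2l//.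
  apply: le_trans (SM _ (in_antidual_dot dotE w)) _.
  have /andP[d0 dw] := antidual_norm_dot dotE w.
  by rewrite (le_trans (ler_wpM2r d0 (ler_norm M)))// ler_wpM2l.
exists v; apply/funext => u.
(* With A u = dot w the chain is g u = g (S (dot w)) = dot v w, the conjugate of dot w v = A u v. *)
have [w Aw] := riesz_representation dotE (Adual u).
by rewrite /adjoint Aw conjcE -dot_conj -[dot v w]/((fun w => dot v w) w) -gv -Aw SA.
Qed.

Lemma adjoint_sum (A : U -> W -> R[i]) n (c : 'I_n -> R[i]) (w : 'I_n -> W) u :
  in_antidual (A u) ->
  adjoint A (\sum_(i < n) c i *: w i) u = \sum_(i < n) c i * adjoint A (w i) u.
Proof.
move=> [Al _]; rewrite /adjoint conjcE.
have A0 : A u 0 = 0.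
  have := Al 1 0 0; rewrite scale1r addr0 conjC1 mul1r => /eqP.
  by rewrite -subr_eq0 opprD addNKr oppr_eq0 => /eqP.
apply: (big_rec2 (fun x y => (A u x)^*%C = y)) => [|i x y _ <-].
  by rewrite A0 conjc0.
by rewrite Al !(rmorphD, rmorphM)/= conjcE conjcK.
Qed.

End adjoint_equation.

(** * Square-integrable complex functions and their integrals *)

Section L2_theory.
Context d (T : measurableType d) (R : realType).
Variables (mu : {measure set T -> \bar R}) (D : set T).
Hypothesis mD : measurable D.
Implicit Types (f g p q : T -> R[i]) (a : R[i]).

Lemma complex_measurable_cst a : complex_measurable D (fun=> a).
Proof. by split; exact: measurable_cst. Qed.

Lemma complex_measurableD f g : complex_measurable D f ->
  complex_measurable D g -> complex_measurable D (fun x => f x + g x).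
Proof.
move=> [f1 f2] [g1 g2]; split.
  rewrite (_ : (fun x => _) = (fun x => complex.Re (f x) + complex.Re (g x))).
    exact: measurable_funD.
  by apply/funext => x; rewrite raddfD.
rewrite (_ : (fun x => _) = (fun x => complex.Im (f x) + complex.Im (g x))).
  exact: measurable_funD.
by apply/funext => x; rewrite raddfD.
Qed.

Lemma complex_measurableM f g : complex_measurable D f ->
  complex_measurable D g -> complex_measurable D (fun x => f x * g x).
Proof.
move=> [f1 f2] [g1 g2]; split.
  rewrite (_ : (fun x => _) = (fun x => complex.Re (f x) * complex.Re (g x) -
      complex.Im (f x) * complex.Im (g x))).
    by apply: measurable_funB; exact: measurable_funM.
  by apply/funext => x; case: (f x) (g x) => ? ? [].
rewrite (_ : (fun x => _) = (fun x => complex.Re (f x) * complex.Im (g x) +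
    complex.Im (f x) * complex.Re (g x))).
  by apply: measurable_funD; exact: measurable_funM.
by apply/funext => x; case: (f x) (g x) => ? ? [].
Qed.

Lemma complex_measurable_conj f : complex_measurable D f ->
  complex_measurable D (fun x => Num.conj (f x)).
Proof.
move=> [f1 f2]; split.
  by rewrite (_ : (fun x => _) = (fun x => complex.Re (f x)))//;
    apply/funext => x; case: (f x).
rewrite (_ : (fun x => _) = (fun x => - complex.Im (f x))).
  exact: measurable_funN.
by apply/funext => x; case: (f x).
Qed.

Lemma complex_measurable_sum n (F : 'I_n -> T -> R[i]) :
  (forall i, complex_measurable D (F i)) ->
  complex_measurable D (fun x => \sum_(i < n) F i x).
Proof.
elim: n F => [|n IH] F mF.
  by under eq_fun do rewrite big_ord0; exact: complex_measurable_cst.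
under eq_fun do rewrite big_ord_recl.
by apply: complex_measurableD => //; exact: IH.
Qed.

Lemma measurable_sqr_rnorm f : complex_measurable D f ->
  measurable_fun D (fun x => rnorm (f x) ^+ 2).
Proof.
move=> [f1 f2]; under eq_fun do rewrite sqr_rnorm.
by apply: measurable_funD; exact: measurable_funX.
Qed.

Lemma measurable_rnorm f : complex_measurable D f ->
  measurable_fun D (fun x => rnorm (f x)).
Proof.
move=> mf; rewrite (_ : (fun x => _) = Num.sqrt \o (fun x => rnorm (f x) ^+ 2)).
  apply: measurableT_comp; last exact: measurable_sqr_rnorm.
  by apply: continuous_measurable_fun; exact: sqrt_continuous.
by apply/funext => x /=; rewrite sqrtr_sqr ger0_norm ?rnorm_ge0.
Qed.

Lemma L2normE {V : normedZmodType R[i]} (f : T -> V) :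
  L2norm mu D f = ((\int[mu]_(x in D) (rnorm (f x) ^+ 2)%:E) `^ 2^-1)%E.
Proof.
rewrite /L2norm Lnorm.unlock [in RHS]integral_mkcond; congr (_ `^ _)%E.
apply: eq_integral => x _; rewrite !patchE.
case: ifPn => _; last by rewrite abse0 poweR0r.
by rewrite /= ger0_norm ?rnorm_ge0// -powR_mulrn// rnorm_ge0.
Qed.

Lemma L2norm_lty {V : normedZmodType R[i]} (f : T -> V) :
  (L2norm mu D f < +oo)%E <->
  (\int[mu]_(x in D) (rnorm (f x) ^+ 2)%:E < +oo)%E.
Proof.
by rewrite L2normE; split; [apply: lty_poweRy|exact: poweR_lty].
Qed.

Lemma integrable_sqr_rnorm f : L2 mu D f ->
  mu.-integrable D (fun x => (rnorm (f x) ^+ 2)%:E).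
Proof.
move=> [mf /L2norm_lty f2]; apply/integrableP; split.
  exact/measurable_EFinP/measurable_sqr_rnorm.
by under eq_integral do rewrite gee0_abs ?lee_fin ?sqr_ge0//.
Qed.

Lemma L2P f (g : T -> R) : complex_measurable D f ->
  mu.-integrable D (EFin \o g) ->
  (forall x, D x -> rnorm (f x) ^+ 2 <= g x) -> L2 mu D f.
Proof.
move=> mf ig fg; split=> //; apply/L2norm_lty.
have /integrableP[_] : mu.-integrable D (fun x => (rnorm (f x) ^+ 2)%:E).
  apply: (le_integrable mD _ _ ig).
    exact/measurable_EFinP/measurable_sqr_rnorm.
  move=> x Dx; rewrite /= lee_fin ger0_norm ?sqr_ge0//.
  by rewrite (le_trans (fg x Dx))// ler_norm.
by under eq_integral do rewrite gee0_abs ?lee_fin ?sqr_ge0//.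
Qed.

Lemma L2_0 : L2 mu D (fun=> 0).
Proof.
apply: (@L2P _ (fun=> 0)); first exact: complex_measurable_cst.
  exact: integrable0.
by move=> x _; rewrite rnorm0 expr0n.
Qed.

Lemma L2D f g : L2 mu D f -> L2 mu D g -> L2 mu D (fun x => f x + g x).
Proof.
move=> f2 g2; apply: (@L2P _
  (fun x => 2 * (rnorm (f x) ^+ 2) + 2 * (rnorm (g x) ^+ 2))).
- by apply: complex_measurableD; [case: f2|case: g2].
- rewrite (_ : _ \o _ = (fun x => 2%:E * (rnorm (f x) ^+ 2)%:E) \+
      (fun x => 2%:E * (rnorm (g x) ^+ 2)%:E))%E//.
  by apply: integrableD => //; apply: integrableZl => //; exact: integrable_sqr_rnorm.
- move=> x _; have := ler_rnormD (f x) (g x).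
  have := rnorm_ge0 (f x + g x); have := rnorm_ge0 (f x); have := rnorm_ge0 (g x).
  move: (rnorm _) (rnorm _) (rnorm _) => r s t r0 s0 t0 h.
  apply: (@le_trans _ _ ((s + t) ^+ 2)).
    by rewrite ler_pXn2r ?nnegrE ?addr_ge0//.
  by have := sqr_ge0 (s - t); lra.
Qed.

Lemma L2Z a f : L2 mu D f -> L2 mu D (fun x => a * f x).
Proof.
move=> f2; apply: (@L2P _ (fun x => rnorm a ^+ 2 * rnorm (f x) ^+ 2)).
- by apply: complex_measurableM; [exact: complex_measurable_cst|case: f2].
- rewrite (_ : _ \o _ = (fun x => (rnorm a ^+ 2)%:E * (rnorm (f x) ^+ 2)%:E))%E//.
  by apply: integrableZl => //; exact: integrable_sqr_rnorm.
- by move=> x _; rewrite rnormM exprMn.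
Qed.

Lemma L2_sum n (F : 'I_n -> T -> R[i]) :
  (forall i, L2 mu D (F i)) -> L2 mu D (fun x => \sum_(i < n) F i x).
Proof.
elim: n F => [|n IH] F mF.
  by under eq_fun do rewrite big_ord0; exact: L2_0.
under eq_fun do rewrite big_ord_recl.
by apply: L2D => //; exact: IH.
Qed.

Definition complex_integrable f :=
  mu.-integrable D (fun x => (complex.Re (f x))%:E) /\
  mu.-integrable D (fun x => (complex.Im (f x))%:E).

Lemma complex_integrable_measurable f :
  complex_integrable f -> complex_measurable D f.
Proof.
by move=> [/integrableP[/measurable_EFinP ? _] /integrableP[/measurable_EFinP ? _]].
Qed.

Lemma complex_integrable_dominated f (g : T -> R) : complex_measurable D f ->
  mu.-integrable D (EFin \o g) -> (forall x, D x -> rnorm (f x) <= g x) ->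
  complex_integrable f.
Proof.
move=> [mf1 mf2] ig fg; split; apply: (le_integrable mD _ _ ig);
  try exact/measurable_EFinP; move=> x Dx; rewrite lee_fin;
  apply: le_trans (le_trans (fg x Dx) (ler_norm _)).
- exact: ler_Re_rnorm.
- exact: ler_Im_rnorm.
Qed.

(** The product is dominated through |f||g| <= |f|^2 + |g|^2. *)
Lemma integrable_mul_conj f g : L2 mu D f -> L2 mu D g ->
  complex_integrable (fun x => f x * Num.conj (g x)).
Proof.
move=> f2 g2; apply: (@complex_integrable_dominated _
    (fun x => rnorm (f x) ^+ 2 + rnorm (g x) ^+ 2)).
- by apply: complex_measurableM; [case: f2|apply: complex_measurable_conj; case: g2].
- rewrite (_ : _ \o _ = (fun x => (rnorm (f x) ^+ 2)%:E) \+
      (fun x => (rnorm (g x) ^+ 2)%:E))%E//.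
  by apply: integrableD => //; exact: integrable_sqr_rnorm.
- move=> x _; rewrite rnormM conjcE rnorm_conj.
  have := rnorm_ge0 (f x); have := rnorm_ge0 (g x).
  by move: (rnorm _) (rnorm _) => r s; nra.
Qed.

Lemma complex_integralD f g : complex_integrable f -> complex_integrable g ->
  complex_integral mu D (fun x => f x + g x) =
  complex_integral mu D f + complex_integral mu D g.
Proof.
move=> [f1 f2] [g1 g2]; rewrite /complex_integral.
under eq_Rintegral do rewrite raddfD/=.
rewrite RintegralD//.
under [X in (_ +i* X)%C]eq_Rintegral do rewrite raddfD/=.
by rewrite RintegralD.
Qed.

Lemma complex_integrableZ a f : complex_integrable f ->
  complex_integrable (fun x => a * f x).
Proof.
move=> [f1 f2]; split.
  rewrite (_ : (fun x => _) = (fun x => (complex.Re a)%:E * (complex.Re (f x))%:E) \-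
      (fun x => (complex.Im a)%:E * (complex.Im (f x))%:E))%E.
    by apply: integrableB => //; exact: integrableZl.
  by apply/funext => x/=; case: a (f x) => ? ? [].
rewrite (_ : (fun x => _) = (fun x => (complex.Re a)%:E * (complex.Im (f x))%:E) \+
    (fun x => (complex.Im a)%:E * (complex.Re (f x))%:E))%E.
  by apply: integrableD => //; exact: integrableZl.
by apply/funext => x/=; case: a (f x) => ? ? [].
Qed.

Lemma complex_integralZ a f : complex_integrable f ->
  complex_integral mu D (fun x => a * f x) = a * complex_integral mu D f.
Proof.
case: a => a b [f1 f2]; rewrite /complex_integral.
have iZ (r : R) (h : T -> R) : mu.-integrable D (fun x => (h x)%:E) ->
    mu.-integrable D (fun x => (r * h x)%:E).
  exact: integrableZl.
rewrite (_ : (fun x => complex.Re _) = (fun x => a * complex.Re (f x) -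
  b * complex.Im (f x))); last by apply/funext => x; case: (f x).
rewrite (_ : (fun x => complex.Im _) = (fun x => a * complex.Im (f x) +
  b * complex.Re (f x))); last by apply/funext => x; case: (f x).
by rewrite RintegralB ?RintegralD ?RintegralZl//; exact: iZ.
Qed.

Lemma complex_integral0 : complex_integral mu D (fun=> 0) = 0.
Proof.
by rewrite /complex_integral !Rintegral_cst ?mul0r.
Qed.

Lemma ae_eq_complex_integral f g : complex_measurable D f ->
  complex_measurable D g -> f = g %[ae mu in D] ->
  complex_integral mu D f = complex_integral mu D g.
Proof.
move=> [f1 f2] [g1 g2] fg; rewrite /complex_integral /Rintegral.
congr (fine _ +i* fine _)%C; apply: ae_eq_integral => //; try exact/measurable_EFinP;
by apply: filterS fg => x /[apply] ->.
Qed.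

(** Real and imaginary parts are estimated separately, which costs the factor 2; this is harmless
    where only boundedness of a functional matters. *)
Lemma complex_integral_bound f : complex_measurable D f ->
  (\int[mu]_(x in D) (rnorm (f x))%:E < +oo)%E ->
  rnorm (complex_integral mu D f) <= 2 * fine (\int[mu]_(x in D) (rnorm (f x))%:E).
Proof.
move=> mf foo.
have inf : mu.-integrable D (fun x => (rnorm (f x))%:E).
  apply/integrableP; split; first exact/measurable_EFinP/measurable_rnorm.
  by under eq_integral do rewrite gee0_abs ?lee_fin ?rnorm_ge0//.
have [if1 if2] := complex_integrable_dominated mf inf (fun _ _ => lexx _).
apply: le_trans (ler_rnorm_ReIm _) _; rewrite mulrDl mul1r /=.
have le_int (h : T -> R) : mu.-integrable D (EFin \o h) ->
    (forall x, `|h x| <= rnorm (f x)) ->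
    `|\int[mu]_(x in D) h x| <= fine (\int[mu]_(x in D) (rnorm (f x))%:E).
  move=> ih hf; apply: le_trans (le_normr_Rintegral mD ih) _.
  by apply: le_Rintegral => //; exact: integrable_norm.
by apply: lerD; apply: le_int => // x; [exact: ler_Re_rnorm|exact: ler_Im_rnorm].
Qed.

(** Hoelder with exponents 2 and 2, applied on the whole space to the extensions by zero [F] and
    [G]. It supplies the explicit constant that mere integrability of the product does not give. *)
Lemma integral_mul_rnorm_le f g : complex_measurable D f -> complex_measurable D g ->
  (\int[mu]_(x in D) (rnorm (f x * Num.conj (g x)))%:E <=
   L2norm mu D f * L2norm mu D g)%E.
Proof.
move=> mf mg.
pose F := (fun x => rnorm (f x)) \_ D; pose G := (fun x => rnorm (g x)) \_ D.
have mF : measurable_fun setT F.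
  by apply/(measurable_restrictT _ mD); exact: measurable_rnorm.
have mG : measurable_fun setT G.
  by apply/(measurable_restrictT _ mD); exact: measurable_rnorm.
have half2 : 2^-1 + 2^-1 = 1 :> R by field.
have := @hoelder _ _ _ mu F G 2 2 mF mG (ltr0n _ 2) (ltr0n _ 2) half2.
have E (h : T -> R[i]) : EFin \o ((fun x => rnorm (h x)) \_ D) =
    (fun x => (rnorm (h x))%:E) \_ D.
  by apply/funext => x; rewrite /= !patchE; case: ifP.
rewrite !E; apply: le_trans.
rewrite Lnorm1 integral_mkcond le_eqVlt; apply/orP; left; apply/eqP.
apply: eq_integral => x _; rewrite /= /F /G !patchE; case: ifPn => _.
  by rewrite ger0_norm ?mulr_ge0 ?rnorm_ge0// rnormM conjcE rnorm_conj.
by rewrite mul0r normr0.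
Qed.

End L2_theory.

(** * The embeddings of a Gelfand triple *)

Section gelfand.
Context d (T : measurableType d) (R : realType).
Variables (mu : {measure set T -> \bar R}) (D : set T).
Hypothesis mD : measurable D.
Variables (V : normedModType R[i]) (i : V -> T -> R[i]).
Hypothesis iG : gelfand_triple mu D i.

Lemma in_antidual_L2 p : L2 mu D p -> in_antidual (L2_to_antidual mu D i p).
Proof.
case: iG => iL2 ilin _ [M iM] _ pL2; split=> [a v w|].
  have iv := integrable_mul_conj mD pL2 (iL2 v).
  have iw := integrable_mul_conj mD pL2 (iL2 w).
  have mp : complex_measurable D p by case: pL2.
  rewrite /L2_to_antidual -complex_integralZ// -complex_integralD//; last first.
    exact: complex_integrableZ.
  (* [i] is linear only up to a null set depending on a, v and w, which the integral does not
     see. *)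
  apply: ae_eq_complex_integral => //.
  - apply: complex_measurableM => //; apply: complex_measurable_conj.
    by case: (iL2 (a *: v + w)).
  - apply: complex_measurableD => //; last exact: complex_integrable_measurable iw.
    exact: complex_integrable_measurable (complex_integrableZ mD _ iv).
  - apply: filterS (ilin a v w) => x /[apply] ->.
    by rewrite rmorphD rmorphM/= mulrDr mulrCA.
have pfin : L2norm mu D p \is a fin_num.
  by rewrite ge0_fin_numE; [case: pL2|exact: Lnorm_ge0].
exists (2 * (fine (L2norm mu D p) * M)) => v.
have bound : (\int[mu]_(x in D) (rnorm (p x * Num.conj (i v x)))%:E <=
    (fine (L2norm mu D p) * (M * rnorm v))%:E)%E.
  have [[mp _] [miv _]] := (pL2, iL2 v).
  apply: le_trans (integral_mul_rnorm_le mu mD mp miv) _.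
  rewrite EFinM fineK//; apply: lee_wpmul2l => //; exact: Lnorm_ge0.
rewrite /L2_to_antidual.
apply: le_trans (complex_integral_bound mD _ (le_lt_trans bound (ltry _))) _.
  apply: complex_measurableM; first by case: pL2.
  by apply: complex_measurable_conj; case: (iL2 v).
rewrite -!mulrA ler_wpM2l// -lee_fin fineK// fin_numElt.
rewrite (le_lt_trans bound (ltry _)) andbT (lt_le_trans (ltNyr 0))//.
by apply: integral_ge0 => x _; rewrite lee_fin rnorm_ge0.
Qed.

Lemma L2_to_antidual_sum n (c : 'I_n -> R[i]) (p : 'I_n -> T -> R[i]) u :
  (forall k, L2 mu D (p k)) ->
  L2_to_antidual mu D i (fun x => \sum_(k < n) p k x * c k) u =
  \sum_(k < n) c k * L2_to_antidual mu D i (p k) u.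
Proof.
case: iG => iL2 _ _ _ _.
elim: n c p => [|n IH] c p pL2.
  rewrite big_ord0 /L2_to_antidual.
  by under eq_fun do rewrite big_ord0 mul0r; exact: complex_integral0.
rewrite big_ord_recl -IH// /L2_to_antidual.
under eq_fun do rewrite big_ord_recl mulrDl mulrAC mulrC.
rewrite complex_integralD// ?complex_integralZ//.
- exact: integrable_mul_conj.
- by apply: complex_integrableZ => //; exact: integrable_mul_conj.
- apply: integrable_mul_conj => //; apply: L2_sum => // k.
  by under eq_fun do rewrite mulrC; exact: L2Z.
Qed.

Lemma gelfand_sum n (c : 'I_n -> R[i]) (w : 'I_n -> V) :
  i (\sum_(k < n) c k *: w k) = (fun x => \sum_(k < n) c k * i (w k) x) %[ae mu in D].
Proof.
case: iG => iL2 ilin _ _ _.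
elim: n c w => [|n IH] c w.
  (* Linearity at 1, 0, 0 reads i 0 = i 0 + i 0 almost everywhere, so the representative of 0
     vanishes almost everywhere. *)
  rewrite big_ord0; have := ilin 1 0 0; rewrite scale1r addr0.
  apply: filterS => x /[apply] h; rewrite big_ord0.
  by move: h; rewrite mul1r => /eqP; rewrite -subr_eq0 opprD addNKr oppr_eq0 => /eqP.
rewrite big_ord_recl.
have := ilin (c ord0) (w ord0) (\sum_(k < n) c (lift ord0 k) *: w (lift ord0 k)).
apply: filterS2 (IH (c \o lift ord0) (w \o lift ord0)) => x h1 h2 Dx.
by rewrite h2// h1// big_ord_recl.
Qed.

End gelfand.

(** * Tensor products and sections on the product space *)

Section product.
Context d (T : measurableType d) (R : realType).
Variables (mu : {sigma_finite_measure set T -> \bar R}) (D : set T).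
Hypothesis mD : measurable D.
Implicit Types (p q : T -> R[i]).

(** By Tonelli the integral of the squared modulus is the product of two finite integrals. Extending
    by zero ([P], [Q]) lets the domain D x D factor along with the integrand. *)
Lemma L2_tensor p q : L2 mu D p -> L2 mu D q ->
  L2 (mu \x mu)%E (D `*` D) (fun z => p z.1 * q z.2).
Proof.
move=> pL2 qL2.
have mDD : measurable (D `*` D) by exact: measurableX.
have m1 (h : T -> R) : measurable_fun D h -> measurable_fun (D `*` D) (fun z => h z.1).
  move=> mh; apply: (measurable_comp mD _ mh); last exact: measurable_funTS.
  by move=> _ [z [Dz _] <-].
have m2 (h : T -> R) : measurable_fun D h -> measurable_fun (D `*` D) (fun z => h z.2).
  move=> mh; apply: (measurable_comp mD _ mh); last exact: measurable_funTS.
  by move=> _ [z [_ Dz] <-].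
split.
  have [[[p1 p2] _] [[q1 q2] _]] := (pL2, qL2).
  by apply: complex_measurableM => //; split; [exact: m1 p1|exact: m1 p2|
    exact: m2 q1|exact: m2 q2].
apply/L2norm_lty.
pose P := (fun x => (rnorm (p x) ^+ 2)%:E) \_ D.
pose Q := (fun x => (rnorm (q x) ^+ 2)%:E) \_ D.
have P0 x : (0 <= P x)%E by rewrite /P patchE; case: ifP; rewrite ?lee_fin ?sqr_ge0.
have Q0 x : (0 <= Q x)%E by rewrite /Q patchE; case: ifP; rewrite ?lee_fin ?sqr_ge0.
have /integrableP[mP Pfin] := integrable_sqr_rnorm pL2.
have /integrableP[mQ Qfin] := integrable_sqr_rnorm qL2.
have {}mP : measurable_fun setT P by apply/(measurable_restrictT _ mD).
have {}mQ : measurable_fun setT Q by apply/(measurable_restrictT _ mD).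
have PQ : (\int[(mu \x mu)%E]_(z in D `*` D) (rnorm (p z.1 * q z.2) ^+ 2)%:E =
    \int[(mu \x mu)%E]_z (P z.1 * Q z.2))%E.
  rewrite integral_mkcond; apply: eq_integral => -[x y] _.
  rewrite /P /Q !patchE in_setX/=; case: ifPn => [/andP[-> ->]|].
    by rewrite rnormM exprMn EFinM.
  by rewrite negb_and => /orP[] /negbTE ->; rewrite ?mul0e ?mule0.
rewrite PQ fubini_tonelli1/=; last 2 first.
- by apply: emeasurable_funM; exact: measurableT_comp.
- by move=> z; exact: mule_ge0.
rewrite /fubini_F/=.
under eq_integral do rewrite ge0_integralZl//.
have intE (h : T -> R[i]) : (\int[mu]_x ((fun x => (rnorm (h x) ^+ 2)%:E) \_ D) x =
    \int[mu]_(x in D) `|(rnorm (h x) ^+ 2)%:E|)%E.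
  rewrite -integral_mkcond; apply: eq_integral => x _.
  by rewrite gee0_abs// lee_fin sqr_ge0.
rewrite ge0_integralZr//; last exact: integral_ge0.
by rewrite /P /Q !intE lte_mul_pinfty// ?ge0_fin_numE// integral_ge0.
Qed.

Lemma ae_ysection (P : T * T -> Prop) : (\forall z \ae (mu \x mu)%E, P z) ->
  \forall y \ae mu, \forall x \ae mu, P (x, y).
Proof.
move=> [N [mN N0 PN]].
(* [\x] integrates the measures of x-sections and [\x^] those of y-sections; uniqueness of the
   product measure permits the exchange. *)
have h : (mu \x mu)%E N = (mu \x^ mu)%E N.
  by apply: product_measure_unique => // A B mA mB; exact: product_measure2E.
have : (\int[mu]_y `|mu (ysection N y)| = 0)%E.
  by rewrite -[RHS]N0 h; apply: eq_integral => y _; rewrite gee0_abs.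
move/(ae_eq_integral_abs mu measurableT).
move=> /(_ (measurable_fun_ysection mu mN)); apply: filterS => y /(_ I) /= Ny.
exists (ysection N y); split => //; first exact: measurable_ysection.
by move=> x Px; rewrite /ysection/= inE; exact: PN.
Qed.

End product.

(** * Bochner square-integrability of finite sums q_k(x') w_k *)

Section strong_measurability.
Context d (T : measurableType d) (R : realType).
Variables (mu : {measure set T -> \bar R}) (D : set T).
Hypothesis mD : measurable D.
Variable V : normedModType R[i].

(** A level set of the composite is a finite union of intersections of level sets of [f] and [g].
    The types [A] and [B] are arbitrary so as to cover both sums in [V] and pairs of real and
    imaginary parts. *)
Lemma simple_on_comp2 (A B : Type) (f : T -> A) (g : T -> B) (F : A -> B -> V) :
  finite_set (f @` D) -> (forall a, measurable (D `&` f @^-1` [set a])) ->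
  finite_set (g @` D) -> (forall b, measurable (D `&` g @^-1` [set b])) ->
  simple_on D (fun x => F (f x) (g x)).
Proof.
move=> ff mf fg mg; split=> [|v].
  apply: sub_finite_set (finite_image2 F ff fg) => _ [x Dx <-].
  by exists (f x); [exists x|exists (g x) => //; exists x].
rewrite (_ : _ `&` _ = \bigcup_(ab in (f @` D `*` g @` D) `&` [set ab | F ab.1 ab.2 = v])
    ((D `&` f @^-1` [set ab.1]) `&` (D `&` g @^-1` [set ab.2]))); last first.
  apply/seteqP; split=> x /=.
    move=> [Dx Fv]; exists (f x, g x) => //=; split => //.
    by split; exists x.
  by move=> [[a b]/= [_ Fv] [[Dx fx] [_ gx]]]; rewrite fx gx.
apply: fin_bigcup_measurable => [|ab _]; last exact: measurableI.
by apply: finite_setIl; exact: finite_setX.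
Qed.

Lemma simple_on0 : simple_on D (fun=> 0 : V).
Proof.
split=> [|v]; first by apply: sub_finite_set (finite_set1 0) => _ [x _ <-].
have [->|v0] := eqVneq v 0.
  by rewrite (_ : _ @^-1` _ = setT) ?setIT//; apply/seteqP; split.
rewrite (_ : _ @^-1` _ = set0) ?setI0//.
by apply/seteqP; split=> x //= v0'; move: v0; rewrite -v0' eqxx.
Qed.

Lemma simple_on_sum n (s : 'I_n -> T -> V) :
  (forall k, simple_on D (s k)) -> simple_on D (fun x => \sum_(k < n) s k x).
Proof.
elim: n s => [|n IH] s ss.
  by under eq_fun do rewrite big_ord0; exact: simple_on0.
under eq_fun do rewrite big_ord_recl.
have [[s0 ms0] [s1 ms1]] := (ss ord0, IH _ (fun k => ss (lift ord0 k))).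
exact: (@simple_on_comp2 _ _ _ _ (fun v w => v + w)).
Qed.

Lemma simple_on_scale (g h : {sfun T >-> R}) (w : V) :
  simple_on D (fun x => (g x +i* h x)%C *: w).
Proof.
have fin (f : {sfun T >-> R}) : finite_set (f @` D).
  exact: fimfun_inP.
have meas (f : {sfun T >-> R}) a : measurable (D `&` f @^-1` [set a]).
  by apply: measurableI => //; exact: measurable_funPTI.
by apply: (@simple_on_comp2 _ _ _ _ (fun a b => (a +i* b)%C *: w)).
Qed.

Lemma measurable_rnorm_simple (s : T -> V) :
  simple_on D s -> measurable_fun D (fun x => rnorm (s x)).
Proof.
move=> [fs ms] _ Y mY.
rewrite (_ : _ `&` _ = \bigcup_(v in s @` D `&` [set v | Y (rnorm v)])
    (D `&` s @^-1` [set v])); last first.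
  apply/seteqP; split=> x /=.
    by move=> [Dx Ysx]; exists (s x) => //; split=> //; exists x.
  by move=> [v [_ Yv] [Dx sx]]; rewrite sx.
by apply: fin_bigcup_measurable => //; exact: finite_setIl.
Qed.

(** [V] carries no sigma-algebra here, so measurability passes to the limit through the real
    functions |s_n|, which converge by the reverse triangle inequality. *)
Lemma measurable_rnorm_lim (s : nat -> T -> V) (f : T -> V) :
  (forall n, simple_on D (s n)) ->
  (forall x, D x -> (fun n => s n x) @ \oo --> f x) ->
  measurable_fun D (fun x => rnorm (f x)).
Proof.
move=> ss sf; apply: (@measurable_fun_cvg _ _ _ _ (fun n x => rnorm (s n x))).
  by move=> n; exact: measurable_rnorm_simple.
move=> x Dx; apply/cvgrPdist_lt => e e0.
have /cvg_rnormP/(_ _ e0) := sf _ Dx; apply: filterS => n; apply: le_lt_trans.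
have := ler_rnormD (f x - s n x) (s n x); rewrite subrK => fs.
have := ler_rnormD (s n x - f x) (f x); rewrite subrK -opprB rnormN => sf'.
by rewrite ler_norml lerNl opprB !lerBlDr sf'.
Qed.

Lemma decomposable_approx n (q : 'I_n -> T -> R[i]) (w : 'I_n -> V) :
  (forall k, complex_measurable D (q k)) ->
  exists s : nat -> T -> V, (forall m, simple_on D (s m)) /\
    forall x, D x -> (fun m => s m x) @ \oo --> \sum_(k < n) q k x *: w k.
Proof.
move=> mq.
have approx (f : T -> R) : measurable_fun D f -> exists g : {sfun T >-> R}^nat,
    forall x, D x -> (fun m => g m x) @ \oo --> f x.
  move=> /measurable_EFinP mf; have [g gf] := approximation_sfun mD mf.
  by exists g => x /gf /fine_cvgP[_].
have [g gq] := choice (fun k => approx _ (mq k).1).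
have [h hq] := choice (fun k => approx _ (mq k).2).
exists (fun m x => \sum_(k < n) (g k m x +i* h k m x)%C *: w k); split=> [m|x Dx].
  by apply: simple_on_sum => k; exact: simple_on_scale.
apply: cvg_big => [|k _]; first exact: add_continuous.
apply/cvg_rnormP => e e0.
(* The 2 accounts for the real and imaginary errors, the 1 for the case w_k = 0. *)
have d0 : 0 < e / (2 * (rnorm (w k) + 1)).
  by rewrite divr_gt0// mulr_gt0// ltr_wpDl// rnorm_ge0.
have /cvgrPdist_lt/(_ _ d0) gqx := gq k x Dx.
have /cvgrPdist_lt/(_ _ d0) hqx := hq k x Dx.
apply: filterS2 gqx hqx => m; rewrite -scalerBl rnormZ.
have := ler_rnorm_ReIm (q k x - (g k m x +i* h k m x)%C); rewrite !raddfB/=.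
move: (rnorm (q k x - _)) `|_| `|_| (rnorm_ge0 (w k)) => r a b w0 rab.
rewrite !ltr_pdivlMr ?mulr_gt0 ?ltr_wpDl//.
move: (rnorm (w k)) w0 => t t0; nra.
Qed.

Lemma bochner_L2_decomposable n (q : 'I_n -> T -> R[i]) (w : 'I_n -> V) :
  (forall k, L2 mu D (q k)) ->
  bochner_L2 mu D (fun x => \sum_(k < n) q k x *: w k).
Proof.
move=> qL2; have [s [ss sq]] := decomposable_approx w (fun k => (qL2 k).1).
split; first by exists s; split=> //; exact: aeW.
have mPsi := measurable_rnorm_lim ss sq.
(* The majorant sum of |w_k||q_k(x)| is real but typed in [R[i]], so that the closure properties of
   [L2] apply to it. *)
pose Q x := \sum_(k < n) (rnorm (w k))%:C%C * (rnorm (q k x))%:C%C : R[i].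
have QL2 : L2 mu D Q.
  apply: L2_sum => // k; apply: L2Z => //.
  have [mq /L2norm_lty fq] := qL2 k.
  split; last by apply/L2norm_lty; under eq_integral do rewrite rnorm_real
    ger0_norm ?rnorm_ge0//.
  by split; [exact: measurable_rnorm|exact: measurable_cst].
apply/L2norm_lty; have [mQ /L2norm_lty] := QL2; apply: le_lt_trans.
apply: ge0_le_integral => //.
- by move=> x _; rewrite lee_fin sqr_ge0.
- by apply/measurable_EFinP; exact: measurable_funX.
- by apply/measurable_EFinP; exact: measurable_sqr_rnorm.
move=> x _; rewrite lee_fin ler_pXn2r ?nnegrE ?rnorm_ge0//.
have -> : rnorm (Q x) = \sum_(k < n) rnorm (q k x) * rnorm (w k).
  rewrite /Q (_ : \sum_(k < n) _ = (\sum_(k < n) rnorm (q k x) * rnorm (w k))%:C%C).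
    by rewrite rnorm_real ger0_norm// sumr_ge0// => k _; rewrite mulr_ge0 ?rnorm_ge0.
  by rewrite rmorph_sum/=; apply: eq_bigr => k _; rewrite mulrC -rmorphM.
apply: (big_rec2 (fun v r => rnorm v <= r)); first by rewrite rnorm0.
move=> k v r _ vr; apply: le_trans (ler_rnormD _ _) _.
by rewrite rnormZ lerD2l.
Qed.

End strong_measurability.

(** * Measurability of the domain *)

Section euclidean.
Variables (R : realType) (d : nat).

(** Openness refers to row vectors and measurability to tuples. The bridge is a countable cover by
    boxes with rational centres and radii 1/(n+1), each measurable coordinate by coordinate. *)
Lemma measurable_open_row_set (Omega : set (Rn R d)) :
  open (row_set Omega) -> measurable Omega.
Proof.
move=> oO.
pose box (qn : 'rV[rat]_d * nat) : set (Rn R d) :=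
  \bigcap_(i in [set: 'I_d]) ((fun x : Rn R d => tnth x i) @^-1`
    ball (ratr (qn.1 0 i) : R) qn.2.+1%:R^-1).
have mbox qn : measurable (box qn).
  apply: fin_bigcap_measurable => [|i _]; first exact: finite_finset.
  rewrite -[X in measurable X]setTI; apply: measurable_tnth => //.
  exact: measurable_ball.
have OE (x : Rn R d) : Omega x = row_set Omega (\row_i tnth x i).
  rewrite /row_set/=; congr Omega; apply: eq_from_tnth => i.
  by rewrite tnth_mktuple mxE.
rewrite (_ : Omega = \bigcup_(qn in [set: 'rV[rat]_d * nat])
    (if `[< box qn `<=` Omega >] then box qn else set0)); last first.
  apply/seteqP; split=> [x Ox|x [qn _]]; last by case: ifPn => [/asboolP/[apply]|].
  have /nbhs_ballP[e /= e0 eO] : nbhs (\row_i tnth x i) (row_set Omega).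
    by apply: open_nbhs_nbhs; split; rewrite // -OE.
  (* A box of radius below e/2 whose centre is within e/2 of x in each coordinate stays inside the
     e-ball around x. *)
  pose n := Num.truncn (2 / e).
  have ne : n.+1%:R^-1 < e / 2.
    by rewrite -[e / 2]invrK ltf_pV2 ?posrE ?invr_gt0 ?divr_gt0// invf_div truncnS_gt.
  have n0 : 0 < n.+1%:R^-1 :> R by rewrite invr_gt0.
  have /choice[q qx] i : exists q : rat, ball (ratr q : R) n.+1%:R^-1 (tnth x i).
    have [|q] := @rat_in_itvoo R (tnth x i - n.+1%:R^-1) (tnth x i + n.+1%:R^-1).
      by rewrite ltrD2l gtrN.
    rewrite in_itv/= => /andP[q1 q2]; exists q.
    by rewrite -ball_normE/= ltr_distl q1.
  have xbox : box (\row_i q i, n) x by move=> i _ /=; rewrite mxE.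
  exists (\row_i q i, n) => //; case: asboolP => // -[] y ybox.
  rewrite OE; apply: eO; split => // i j; rewrite !mxE.
  apply: le_ball (ltW _) _ _; last first.
    apply: (@ball_triangle _ _ (ratr (q j) : R)); first exact/ball_sym/qx.
    by have := ybox j I; rewrite /= mxE; exact.
  by rewrite [ltRHS]splitr; exact: ltrD.
apply: countable_bigcupT_measurable => [|qn]; first exact: countableP.
by case: ifP.
Qed.

End euclidean.

(** * The extended adjoint equation *)

Lemma in_antidual_model (R : realType) (X : normedModType R)
    (U V : normedModType R[i]) (K : U -> V -> R[i]) (B : U -> X -> V -> R[i])
    (theta : X) :
  bounded_to_antidual K -> bounded_bilinear B ->
  forall u, in_antidual (model K B theta u).
Proof.
move=> [Kdual _ _] [Bdual _ _] u.
by have [Bu _ _] := Bdual u; exact: in_antidualD.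
Qed.

Theorem lemma3p4 (R : realType) (d : nat) (Omega : set (Rn R d))
  (Omega_smooth : smooth_domain Omega)
  (X : completeNormedModType R) (U W : completeNormedModType R[i])
  (X_hilbert : real_hilbert X)
  (U_hilbert : complex_hilbert U) (W_hilbert : complex_hilbert W)
  (iU : U -> Rn R d -> R[i]) (iW : W -> Rn R d -> R[i])
  (U_gelfand : gelfand_triple (lebesgue_Rn R d) Omega iU)
  (W_gelfand : gelfand_triple (lebesgue_Rn R d) Omega iW)
  (K : U -> W -> R[i]) (B : U -> X -> W -> R[i])
  (K_bounded : bounded_to_antidual K) (B_bounded : bounded_bilinear B)
  (DD : set X)
  (D_invertible : forall theta, DD theta -> boundedly_invertible (model K B theta))
  (theta : X) (theta_DD : DD theta)
  (y : Rn R d * Rn R d -> R[i]) (y_sep : Ysep (lebesgue_Rn R d) Omega y) :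
  exists (Psi : Rn R d -> W) (psi : Rn R d * Rn R d -> R[i]),
    [/\ bochner_L2 (lebesgue_Rn R d) Omega Psi,
        viewed_as (lebesgue_Rn R d) Omega iW Psi psi,
        Ysep (lebesgue_Rn R d) Omega psi
      & \forall x' \ae lebesgue_Rn R d, Omega x' ->
          adjoint (model K B theta) (Psi x') =
          L2_to_antidual (lebesgue_Rn R d) Omega iU (fun x => y (x, x'))].
Proof.
set mu := lebesgue_Rn R d.
have [oOmega _ _ _] := Omega_smooth.
have mOmega := measurable_open_row_set oOmega.
have mOO : measurable (Omega `*` Omega) by exact: measurableX.
have Adual := in_antidual_model theta K_bounded B_bounded.
have [yL2 [n [p [q [pL2 qL2 y_pq]]]]] := y_sep.
have [w wE] := choice (fun k => adjoint_surjective W_hilbert Adual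
  (D_invertible _ theta_DD) (in_antidual_L2 mOmega U_gelfand (pL2 k))).
have [iWL2 _ _ _ _] := W_gelfand.
exists (fun x' => \sum_(k < n) q k x' *: w k).
exists (fun z => \sum_(k < n) iW (w k) z.1 * q k z.2); split.
- exact: bochner_L2_decomposable.
- apply: aeW => x' _.
  apply: filterS (gelfand_sum W_gelfand (q^~ x') w) => x /[apply] ->.
  by apply: eq_bigr => k _; rewrite mulrC.
- split; last by exists n, (fun k => iW (w k)), q; split=> //; exact: aeW.
  by apply: L2_sum => // k; exact: L2_tensor.
(* The exceptional set of x' is fixed here, before any test vector u is introduced. *)
apply: filterS (ae_ysection y_pq) => x' yx' Ox'.
apply/funext => u; rewrite adjoint_sum//.
under eq_bigr do rewrite wE.
rewrite -(L2_to_antidual_sum mOmega U_gelfand)//.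
have [iUL2 _ _ _ _] := U_gelfand.
have miu : complex_measurable Omega (fun x => Num.conj (iU u x)).
  by apply: complex_measurable_conj; case: (iUL2 u).
apply: ae_eq_complex_integral => //.
- apply: complex_measurableM => //; apply: complex_measurable_sum => k.
  by apply: complex_measurableM; [case: (pL2 k)|exact: complex_measurable_cst].
(* The section of y at x' is its composition with x |-> (x, x'), which maps [Omega] into [Omega] x
   [Omega] because x' lies in [Omega]. *)
- apply: complex_measurableM => //; have [[y1 y2] _] := yL2.
  have section (h : Rn R d * Rn R d -> R) : measurable_fun (Omega `*` Omega) h ->
      measurable_fun Omega (fun x => h (x, x')).
    move=> mh; apply: (measurable_comp mOO _ mh) => [_ [x Ox <-]//|].
    by apply: measurable_funTS; exact: pair2_measurable.
  by split; [exact: section y1|exact: section y2].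
- by apply: filterS yx' => x yx Ox; rewrite yx.
Qed.
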